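(* Let $K$ be a field, $1\le d\le n$, and let $I=I_{n,d}\subset S=K[x_1,\dots,x_n]$. Then, for all $k\ge1$: (a) $$I^{(k)}=\sum_{m=1}^k\ \Big(\sum_{\substack{s_1+\dots+s_m=k-m\\ 0\le s_1,\dots,s_m\le n-d}}I_{n,d+s_1}\cdots I_{n,d+s_m}\Big).$$ (b) $\beta_{0,\ell}(I^{(k)})\ne0$ if and only if $\ell=m(d-1)+k$ for some integer $m$ with $\lceil k/(n-d+1)\rceil\le m\le k$. (c) $\omega(I^{(k)})=dk$.
   Context: For positive integers $n,e$, $I_{n,e}\subset S=K[x_1,\dots,x_n]$ is the squarefree Veronese ideal of degree $e$, generated by all squarefree monomials of degree $e$ in $S$. The $k$th symbolic power is $I^{(k)}=\bigcap_{P\in\mathrm{Ass}(I)}(I^kS_P\cap S)$, with $\mathrm{Ass}(I)=\mathrm{Ass}(S/I)$. $\beta_{0,\ell}(L)$ is the number of minimal generators of degree $\ell$ of a graded ideal $L$, and $\omega(L)$ is the largest degree of a minimal generator of $L$. *)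

(* Defs.v *)
From HB Require Import structures.
From Stdlib Require Import ClassicalEpsilon.
From mathcomp Require Import all_boot all_order all_algebra.
From mathcomp Require Export mpoly.

Set Implicit Arguments.
Unset Strict Implicit.
Unset Printing Implicit Defensive.

Import GRing.Theory.
Local Open Scope ring_scope.

(* Ideals are Prop-valued predicates compared extensionally: MathComp's ideals
   are boolean predicates, and membership is not decidable in general here. *)

Section CommutativeRings.
Variable R : comNzRingType.
Implicit Types I J P : R -> Prop.

Definition ideal_eq I J : Prop := forall f, I f <-> J f.

Definition is_ideal I : Prop :=
  [/\ I 0, forall f g, I f -> I g -> I (f + g) & forall a f, I f -> I (a * f)].

Definition prime_ideal P : Prop :=
  [/\ is_ideal P, ~ P 1 & forall a b, P (a * b) -> P a \/ P b].

Definition ideal_gen (G : R -> Prop) : R -> Prop := fun f =>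
  exists2 s : seq (R * R), (forall c, c \in s -> G c.2)
                         & f = \sum_(c <- s) c.1 * c.2.

Definition ideal0 : R -> Prop := fun f => f = 0.

Definition ideal1 : R -> Prop := fun _ => True.

Definition ideal_add I J : R -> Prop := fun f =>
  exists g h, [/\ I g, J h & f = g + h].

Definition ideal_mul I J : R -> Prop :=
  ideal_gen (fun f => exists g h, [/\ I g, J h & f = g * h]).

Definition ideal_exp I (k : nat) : R -> Prop := iter k (ideal_mul I) ideal1.

(* P is in Ass(R/I): P is prime and is the annihilator (I : f) of the class of
   some f in R/I. *)
Definition associated_prime I P : Prop :=
  prime_ideal P /\ exists f, forall a, P a <-> I (a * f).

End CommutativeRings.

Section SymbolicPowers.
Variable R : idomainType.
Implicit Types I J P : R -> Prop.

Local Notation "x %:F" := (@FracField.tofrac R x).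

(* R_P as a subring of the fraction field of the domain R. *)
Definition local_ring P : {fraction R} -> Prop := fun z =>
  exists a s : R, ~ P s /\ z = a%:F / s%:F.

(* The extended ideal J R_P. *)
Definition ideal_extension P J : {fraction R} -> Prop := fun z =>
  exists2 c : seq ({fraction R} * R),
    (forall t, t \in c -> local_ring P t.1 /\ J t.2)
  & z = \sum_(t <- c) t.1 * t.2%:F.

Definition symbolic_power I (k : nat) : R -> Prop := fun f =>
  forall P, associated_prime I P -> ideal_extension P (ideal_exp I k) f%:F.

End SymbolicPowers.

Section Polynomials.
Variables (K : fieldType) (n : nat).
Implicit Types L : {mpoly K[n]} -> Prop.

Definition squarefree_monomial (e : nat) (f : {mpoly K[n]}) : Prop :=
  exists m : 'X_{1..n}, [/\ mdeg m = e, forall i, (m i <= 1)%N & f = 'X_[m]].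

Definition veronese (e : nat) : {mpoly K[n]} -> Prop :=
  ideal_gen (squarefree_monomial e).

Definition generates (G : seq {mpoly K[n]}) L : Prop :=
  ideal_eq (ideal_gen (fun g => g \in G)) L.

Definition is_mingens L (G : seq {mpoly K[n]}) : Prop :=
  [/\ uniq G,
      forall g, g \in G -> exists e : nat, g \is e.-homog,
      generates G L
    & forall H, {subset H <= G} -> generates H L -> {subset G <= H}].

(* For a graded ideal L such a system exists, since the polynomial ring is
   Noetherian, and by the graded Nakayama lemma the number of its members of
   each degree depends only on L, so beta0 and omega do not depend on the
   choice made here. *)
Definition mingens L : seq {mpoly K[n]} :=
  epsilon (inhabits [::]) (is_mingens L).

(* Total degree; members of a minimal system are nonzero, so the value at 0
   is irrelevant. *)
Definition tdeg (f : {mpoly K[n]}) : nat := (msize f).-1.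

Definition beta0 L (l : nat) : nat := count (fun g => tdeg g == l) (mingens L).

Definition omega L : nat := (\max_(g <- mingens L) tdeg g)%N.

End Polynomials.

(* Main.v *)
From HB Require Import structures.
Require Import Defs.
From Stdlib Require Import ClassicalEpsilon Classical.
From mathcomp Require Import all_boot all_order all_algebra.
From mathcomp Require Import mpoly zify.

(** The symbolic power is a monomial ideal cut out by linear inequalities on
    exponent vectors; after that, everything is combinatorics of exponents.

    For a set F of n - d + 1 indices let P_F be the prime generated by the
    variables of F.  The Veronese ideal I is the intersection of the P_F, and
    P_F is the annihilator modulo I of the product of the variables outside F.
    The power of P_F of exponent k is spanned by the monomials of weight at
    least k, the weight being the degree in the variables of F; it is primary,
    because the weight is the order of a t-adic filtration
    ([weight_ideal_primary]).  Hence a member of the symbolic power lies in the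
    k-th power of every P_F.  Conversely any associated prime is contained in
    some P_F ([associated_prime_sub]), and there the k-th power of the product of
    the variables outside F is a denominator that moves the k-th power of P_F
    into that of I.  So x^m belongs to the symbolic power exactly when every F
    has weight at least k on m ([symbolic_veroneseP]).

    A squarefree monomial of degree d + j has weight at least j + 1 on every F,
    which bounds the products in (a).  Conversely, removing the radical of x^m,
    of degree d + j say, lowers the least weight by j + 1 only, so an induction
    on k writes x^m as a multiple of a product of m' squarefree monomials whose
    excesses j + 1 add up to k ([symbolic_mnm_factor]); this is (a).

    Such a product has degree m' (d - 1) + k, and m' <= k <= m' (n - d + 1),
    so only the degrees of (b) occur.  For a monomial ideal, the degrees of a
    minimal homogeneous system of generators are those of the minimal monomials
    ([beta0_minimal]), and for every admissible q an explicit minimal monomial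
    has degree q (d - 1) + k ([greedy_minimal]).  The largest degree is reached
    for q = k, which gives (c). *)

Set Implicit Arguments.
Unset Strict Implicit.
Unset Printing Implicit Defensive.

Import Order.TTheory GRing.Theory Num.Theory.
Local Open Scope ring_scope.

(** * Ideals as predicates *)

Section Ideals.
Variable R : comNzRingType.
Implicit Types (I J L P G : R -> Prop) (f g : R).

Lemma ideal_sum I (T : eqType) (r : seq T) (F : T -> R) :
  is_ideal I -> (forall i, i \in r -> I (F i)) -> I (\sum_(i <- r) F i).
Proof.
case=> I0 ID _ h; rewrite big_seq; elim/big_ind: _ => //.
Qed.

Lemma ideal_gen_is_ideal G : is_ideal (ideal_gen G).
Proof.
split.
- by exists [::] => //; rewrite big_nil.
- move=> _ _ [s hs ->] [t ht ->]; exists (s ++ t); last by rewrite big_cat.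
  by move=> c; rewrite mem_cat => /orP[/hs|/ht].
- move=> a _ [s hs ->]; exists [seq (a * c.1, c.2) | c <- s].
    by move=> _ /mapP[c /hs Gc ->].
  by rewrite big_map mulr_sumr; apply: eq_bigr => c _; rewrite mulrA.
Qed.

Lemma mem_ideal_gen G f : G f -> ideal_gen G f.
Proof.
move=> Gf; exists [:: (1, f)]; first by move=> c; rewrite inE => /eqP->.
by rewrite big_seq1 mul1r.
Qed.

Lemma ideal_gen_sub G L :
  is_ideal L -> (forall f, G f -> L f) -> forall f, ideal_gen G f -> L f.
Proof.
move=> Lid GL _ [s hs ->]; apply: ideal_sum => // c cs.
by case: Lid => _ _; apply; apply: GL; apply: hs.
Qed.

Lemma ideal_gen_mono (G H : R -> Prop) :
  (forall f, G f -> H f) -> forall f, ideal_gen G f -> ideal_gen H f.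
Proof.
move=> GH; apply: ideal_gen_sub (ideal_gen_is_ideal H) _ => f Gf.
exact/mem_ideal_gen/GH.
Qed.

Lemma ideal0_is_ideal : is_ideal (@ideal0 R).
Proof.
by rewrite /ideal0; split=> [|f g -> ->|a f ->]; rewrite ?addr0 ?mulr0.
Qed.

Lemma ideal_add_is_ideal I J :
  is_ideal I -> is_ideal J -> is_ideal (ideal_add I J).
Proof.
move=> [I0 ID IM] [J0 JD JM]; split.
- by exists 0, 0; split; rewrite ?addr0.
- move=> _ _ [g [h [Ig Jh ->]]] [g' [h' [Ig' Jh' ->]]].
  by exists (g + g'), (h + h'); split; rewrite 1?addrACA; auto.
- move=> a _ [g [h [Ig Jh ->]]].
  by exists (a * g), (a * h); split; rewrite 1?mulrDr; auto.
Qed.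

Lemma ideal_big_add_is_ideal (T : Type) (r : seq T) (P : pred T)
    (F : T -> R -> Prop) :
  (forall i, P i -> is_ideal (F i)) ->
  is_ideal (\big[@ideal_add R / @ideal0 R]_(i <- r | P i) F i).
Proof.
move=> Fid; elim/big_ind: _ => //; first exact: ideal0_is_ideal.
exact: ideal_add_is_ideal.
Qed.

Lemma mem_ideal_big_add (T : eqType) (r : seq T) (P : pred T)
    (F : T -> R -> Prop) i f :
  (forall j, P j -> is_ideal (F j)) -> i \in r -> P i -> F i f ->
  (\big[@ideal_add R / @ideal0 R]_(j <- r | P j) F j) f.
Proof.
move=> Fid; elim: r => // j r IHr; rewrite inE big_cons => ir Pi Fi.
case: ifP => [Pj|nPj].
  have [eij|neij] := eqVneq i j.
    exists f, 0; split; rewrite ?addr0 -?eij //.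
    by case: (ideal_big_add_is_ideal r Fid).
  exists 0, f; split; rewrite ?add0r //; first by case: (Fid j Pj).
  by apply: IHr => //; move: ir; rewrite (negPf neij).
by apply: IHr => //; case/orP: ir => // /eqP eij; rewrite -eij Pi in nPj.
Qed.

Lemma ideal_big_add_sub (T : eqType) (r : seq T) (P : pred T)
    (F : T -> R -> Prop) L :
  is_ideal L -> (forall i, i \in r -> P i -> forall f, F i f -> L f) ->
  forall f, (\big[@ideal_add R / @ideal0 R]_(i <- r | P i) F i) f -> L f.
Proof.
move=> [L0 LD LM] FL; rewrite big_seq_cond.
elim/big_ind: _ => [f -> //|I J IL JL _ [g [h [/IL Lg /JL Lh ->]]]|].
  exact: LD.
by move=> i /andP[]; apply: FL.
Qed.

Lemma ideal_big_mul_is_ideal (T : Type) (r : seq T) (P : pred T)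
    (F : T -> R -> Prop) :
  (forall i, P i -> is_ideal (F i)) ->
  is_ideal (\big[@ideal_mul R / @ideal1 R]_(i <- r | P i) F i).
Proof.
by move=> Fid; elim/big_ind: _ => // *; apply: ideal_gen_is_ideal.
Qed.

Lemma mem_ideal_mul I J f g : I f -> J g -> ideal_mul I J (f * g).
Proof. by move=> If Jg; apply: mem_ideal_gen; exists f, g. Qed.

Lemma ideal_exp_is_ideal I k : is_ideal (ideal_exp I k).
Proof. by case: k => // k; apply: ideal_gen_is_ideal. Qed.

End Ideals.

(** * Localization at a prime *)

Section Localization.
Variable R : idomainType.
Implicit Types (I J P : R -> Prop) (f g : R).

(** Clearing the finitely many denominators, whose product stays outside the
    prime. *)
Lemma ideal_extensionP P J f : prime_ideal P -> is_ideal J ->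
  ideal_extension P J (FracField.tofrac f) <-> exists2 s, ~ P s & J (s * f).
Proof.
move=> [[P0 _ PM] P1 Pprime] Jid; split; last first.
  move=> [s Ps Jsf]; have s0 : s != 0 by apply: contra_notN Ps => /eqP->.
  exists [:: (1 / FracField.tofrac s, s * f)].
    by move=> t; rewrite inE => /eqP->; split=> //; exists 1, s; rewrite tofrac1.
  by rewrite big_seq1 /= tofracM mul1r mulKf // tofrac_eq0.
move=> [c hc Ef].
suff [s Ps [j Jj Ej]] : exists2 s, ~ P s & exists2 j, J j &
    FracField.tofrac s * FracField.tofrac f = FracField.tofrac j.
  by exists s => //; move/eqP: Ej; rewrite -tofracM tofrac_eq => /eqP->.
rewrite {}Ef; elim: c hc => [|[z g] c IHc] hc.
  by exists 1 => //; exists 0; [case: Jid | rewrite big_nil mulr0 tofrac0].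
case: IHc => [t tc|s Ps [j Jj Ej]]; first by apply: hc; rewrite inE tc orbT.
have [/= [a [b [Pb Ez]]] Jg] := hc _ (mem_head _ _).
have b0 : FracField.tofrac b != 0.
  by rewrite tofrac_eq0; apply: contra_notN Pb => /eqP->.
exists (b * s); first by move=> /Pprime[].
exists (s * a * g + b * j).
  by case: Jid => _ JD JM; apply: JD; apply: JM.
rewrite big_cons /= mulrDr tofracM -[X in _ + X]mulrA Ej Ez tofracD !tofracM.
congr (_ + _); rewrite !mulrA; congr (_ * _).
by rewrite -[X in X / _]mulrA mulrAC divff // mul1r.
Qed.

End Localization.

(** * Weights of monomials and the primary ideals they define *)

Section Weights.
Variable n : nat.
Implicit Types (F A : {set 'I_n}) (m : 'X_{1..n}).

Definition weight F m : nat := (\sum_(i in F) m i)%N.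

Definition sqfree_mnm A : 'X_{1..n} := [multinom (i \in A : nat) | i < n].

Lemma weightD F m1 m2 : weight F (m1 + m2)%MM = (weight F m1 + weight F m2)%N.
Proof. by rewrite -big_split; apply: eq_bigr => i _; rewrite mnmDE. Qed.

Lemma weight0 F : weight F 0%MM = 0%N.
Proof. by rewrite /weight big1 // => i _; rewrite mnm0E. Qed.

Lemma leq_weight F m1 m2 : (m1 <= m2)%MM -> (weight F m1 <= weight F m2)%N.
Proof. by move/mnm_lepP => h; apply: leq_sum => i _. Qed.

Lemma weight_gt0 F m : (0 < weight F m)%N -> exists2 i, i \in F & m i != 0%N.
Proof.
move=> wF; apply/exists_inP; apply: contraLR wF => /exists_inPn m0.
by rewrite -eqn0Ngt /weight big1 // => i /m0; rewrite negbK => /eqP.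
Qed.

Lemma weight_sqfree F A : weight F (sqfree_mnm A) = #|F :&: A|.
Proof.
rewrite /weight -sum1_card big_mkcond [RHS]big_mkcond.
by apply: eq_bigr => i _; rewrite mnmE inE; case: (i \in F); case: (i \in A).
Qed.

Lemma mdeg_weightT m : mdeg m = weight [set: 'I_n] m.
Proof. by rewrite mdegE /weight; apply: eq_bigl => i; rewrite inE. Qed.

Lemma mdeg_sqfree A : mdeg (sqfree_mnm A) = #|A|.
Proof. by rewrite mdeg_weightT weight_sqfree setTI. Qed.

(** The exponent vectors of the monomials of the symbolic power: every prime
    generated by n - d + 1 variables imposes one linear inequality. *)
Definition symbolic_mnm (d k : nat) m : bool :=
  [forall F : {set 'I_n}, (#|F| + d == n.+1)%N ==> (k <= weight F m)%N].

Lemma symbolic_mnmP d k m :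
  reflect (forall F, (#|F| + d = n.+1)%N -> (k <= weight F m)%N)
          (symbolic_mnm d k m).
Proof.
apply: (iffP forallP) => [h F /eqP cF|h F]; first exact: (implyP (h F)).
by apply/implyP => /eqP /h.
Qed.

End Weights.

(** In the t-adic filtration the lowest term of a product is the product of the
    lowest terms. *)
Lemma poly_adic_regular (D : idomainType) k (p q : {poly D}) :
  p`_0 != 0 -> (forall j, (j < k)%N -> (p * q)`_j = 0) ->
  forall j, (j < k)%N -> q`_j = 0.
Proof.
move=> p0 pq; elim/ltn_ind => j IHj jk; apply: (mulfI p0).
rewrite mulr0; apply: etrans (pq j jk); rewrite coefM big_ord_recl subn0.
rewrite big1 ?addr0 // => i _.
rewrite IHj ?mulr0 //=; last exact: leq_ltn_trans (leq_subr _ _) jk.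
by case: j i {IHj jk} => [[] //|j i]; rewrite subSS ltnS leq_subr.
Qed.

Section WeightIdeals.
Variables (K : fieldType) (n : nat).
Implicit Types (F A : {set 'I_n}) (m u v : 'X_{1..n}) (f g : {mpoly K[n]}).
Implicit Type L : {mpoly K[n]} -> Prop.

Lemma ideal_msupp L f : is_ideal L ->
  (forall m, m \in msupp f -> L 'X_[m]) -> L f.
Proof.
move=> Lid h; rewrite (mpolyE f); apply: ideal_sum => // m /h Lm.
by rewrite -mul_mpolyC; case: Lid => _ _; apply.
Qed.

Lemma ideal_mnm_le L u m : is_ideal L -> (u <= m)%MM -> L 'X_[u] -> L 'X_[m].
Proof.
by case=> _ _ LM /submK <- Lu; rewrite mpolyXD; apply: LM.
Qed.

(** For an upward closed U, the ideal spanned by the monomials of U. *)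
Definition mnm_ideal (U : pred 'X_{1..n}) f : Prop :=
  forall m, m \in msupp f -> U m.

Lemma mnm_ideal_is_ideal (U : pred 'X_{1..n}) :
  (forall u v, U u -> U (u + v)%MM) -> is_ideal (mnm_ideal U).
Proof.
move=> Uup; split=> [m|f g Uf Ug m|a f Uf m]; first by rewrite msupp0.
- by move/msuppD_le; rewrite mem_cat => /orP[/Uf|/Ug].
- move/msuppM_le/allpairsP => [[m1 m2] /= [_ /Uf Um2 ->]].
  by rewrite addmC; apply: Uup.
Qed.

Lemma mnm_idealX (U : pred 'X_{1..n}) m : mnm_ideal U 'X_[m] <-> U m.
Proof.
split=> [h|Um u]; first by apply: h; rewrite msuppX inE.
by rewrite msuppX inE => /eqP->.
Qed.

(** The k-th power of the prime generated by the variables indexed by F. *)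
Definition weight_ideal F k := mnm_ideal (fun m => (k <= weight F m)%N).

Lemma weight_ideal_is_ideal F k : is_ideal (weight_ideal F k).
Proof.
apply: mnm_ideal_is_ideal => u v ku; rewrite weightD.
exact: leq_trans (leq_addr _ _).
Qed.

Lemma weight_idealM F k l f g :
  weight_ideal F k f -> weight_ideal F l g -> weight_ideal F (k + l) (f * g).
Proof.
move=> kf lg m /msuppM_le/allpairsP[[u v] /= [/kf ku /lg lv ->]].
by rewrite weightD leq_add.
Qed.

(** The substitution multiplying the variables of F by a new variable t; the
    power of t records the weight, and t is a prime element. *)
Definition weight_grading F : {mpoly K[n]} -> {poly {mpoly K[n]}} :=
  mmap (polyC \o mpolyC n (R := K)) (fun i => ('X_i)%:P * 'X^(i \in F)).

HB.instance Definition _ F := GRing.RMorphism.on (weight_grading F).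

Lemma weight_gradingX F m :
  weight_grading F 'X_[m] = ('X_[m])%:P * 'X^(weight F m).
Proof.
rewrite /weight_grading mmapX /mmap1 mpolyXE_id rmorph_prod /weight.
rewrite [X in 'X^X]big_mkcond expr_sum -big_split; apply: eq_bigr => i _ /=.
by rewrite exprMn -exprM rmorphXn; case: (i \in F); rewrite ?mul1n ?mul0n.
Qed.

Lemma coef_weight_grading F f j m :
  (weight_grading F f)`_j@_m = if weight F m == j then f@_m else 0.
Proof.
have -> : (if weight F m == j then f@_m else 0) =
  \sum_(u <- msupp f) if weight F m == j then f@_u * (u == m)%:R else 0.
  case: eqP => _; last by rewrite big1.
  rewrite {1}(mpolyE f) raddf_sum /=; apply: eq_bigr => u _.
  by rewrite mcoeffZ mcoeffX.
rewrite {1}(mpolyE f) raddf_sum coef_sum raddf_sum /=; apply: eq_bigr => u _.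
rewrite -mul_mpolyC rmorphM /= weight_gradingX /weight_grading mmapC /=.
rewrite !coefCM coefXn mcoeffCM [_ == weight _ _]eq_sym.
rewrite mulr_natr mcoeffMn mcoeffX.
have [<-|_] := eqVneq u m; last by rewrite mul0rn mulr0 if_same.
by case: (_ == j); rewrite ?mulr0.
Qed.

Lemma weight_idealP F k f :
  weight_ideal F k f <-> forall j, (j < k)%N -> (weight_grading F f)`_j = 0.
Proof.
split=> [kf j jk|h m].
  apply/mpolyP => m; rewrite coef_weight_grading mcoeff0.
  case: eqP => // wj; apply: memN_msupp_eq0; apply: contraL jk => /kf.
  by rewrite wj -leqNgt.
rewrite mcoeff_msupp leqNgt; apply: contraNN => wk.
by move: (coef_weight_grading F f (weight F m) m); rewrite h // eqxx mcoeff0 => <-.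
Qed.

(** The powers of a prime generated by variables are primary: under the grading
    an element outside the prime has a nonzero constant term in t. *)
Lemma weight_ideal_primary F k f s :
  ~ weight_ideal F 1 s -> weight_ideal F k (s * f) -> weight_ideal F k f.
Proof.
move=> s1 /weight_idealP ksf; apply/weight_idealP.
apply: (@poly_adic_regular _ k (weight_grading F s)).
  by apply: contra_notN s1 => /eqP s0; apply/weight_idealP; case.
by move=> j /ksf; rewrite rmorphM.
Qed.

Lemma weight_ideal_prime F : prime_ideal (weight_ideal F 1).
Proof.
split; first exact: weight_ideal_is_ideal.
  by rewrite -mpolyX0 => /mnm_idealX; rewrite weight0.
move=> a b Fab; case: (classic (weight_ideal F 1 a)) => [|Fa]; first by left.
by right; apply: weight_ideal_primary Fab.
Qed.

End WeightIdeals.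

(** * Factoring monomials into squarefree ones *)

Lemma subset_of_card (T : finType) (A : {set T}) c :
  (c <= #|A|)%N -> exists2 B : {set T}, B \subset A & #|B| = c.
Proof.
move=> cA; exists [set x in take c (enum A)].
  by apply/subsetP => x; rewrite inE => /mem_take; rewrite mem_enum.
rewrite cardsE; have /card_uniqP -> : uniq (take c (enum A)).
  exact/take_uniq/enum_uniq.
by rewrite size_takel // -cardE.
Qed.

Lemma sum_minn_blocks q k N :
  (\sum_(j < N) minn q (k - j * q) = minn (N * q) k)%N.
Proof.
elim: N => [|N IHN]; first by rewrite big_ord0 min0n.
by rewrite big_ord_recr IHN /= mulSn; move: (N * q)%N => u; lia.
Qed.

Section Factorization.
Variables (n d : nat).
Implicit Types (F A : {set 'I_n}) (m u v : 'X_{1..n}) (s : seq {set 'I_n}).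

Definition mnm_supp m : {set 'I_n} := [set i | m i != 0%N].

Lemma sqfree_mnm_le A m : (sqfree_mnm A <= m)%MM = (A \subset mnm_supp m).
Proof.
apply/mnm_lepP/subsetP => h i.
  by move=> iA; have := h i; rewrite mnmE iA inE lt0n.
by rewrite mnmE; case: (boolP (i \in A)) => // /h; rewrite inE lt0n.
Qed.

(** A set F of n - d + 1 indices misses only d - 1 of them. *)
Lemma leq_card_setI F A : (#|F| + d = n.+1)%N -> (d <= #|A|)%N ->
  ((#|A| - d).+1 <= #|F :&: A|)%N.
Proof.
move=> cF dA; have := cardsUI F A; have := max_card (F :|: A).
by rewrite card_ord; lia.
Qed.

Definition sqfree_prod s : 'X_{1..n} := (\sum_(A <- s) sqfree_mnm A)%MM.

Lemma weight_sqfree_prod F s :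
  weight F (sqfree_prod s) = (\sum_(A <- s) #|F :&: A|)%N.
Proof.
rewrite /sqfree_prod; elim: s => [|A s IHs]; first by rewrite !big_nil weight0.
by rewrite !big_cons weightD weight_sqfree IHs.
Qed.

(** A squarefree monomial of degree d + j has weight at least j + 1 on every set
    of n - d + 1 indices, so products of such factors with total excess k
    have weight at least k. *)
Definition sqfree_factors k s :=
  all (fun A => (d <= #|A|)%N) s /\ (\sum_(A <- s) (#|A| - d).+1 = k)%N.

Lemma symbolic_sqfree_prod k s :
  sqfree_factors k s -> symbolic_mnm d k (sqfree_prod s).
Proof.
case=> /allP ds <-; apply/symbolic_mnmP => F cF.
rewrite weight_sqfree_prod big_seq [leqRHS]big_seq.
by apply: leq_sum => A /ds; apply: leq_card_setI.
Qed.

Lemma symbolic_mnm_le k u m :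
  (u <= m)%MM -> symbolic_mnm d k u -> symbolic_mnm d k m.
Proof.
move=> um /symbolic_mnmP ku; apply/symbolic_mnmP => F /ku.
by move/leq_trans; apply; apply: leq_weight.
Qed.

Hypothesis hd : (1 <= d <= n)%N.

Lemma leq_card_supp k m :
  (0 < k)%N -> symbolic_mnm d k m -> (d <= #|mnm_supp m|)%N.
Proof.
move=> k0 /symbolic_mnmP km; rewrite leqNgt; apply/negP => lt_d.
have [F /subsetP sF cF] : exists2 F : {set 'I_n},
    F \subset ~: mnm_supp m & #|F| = (n.+1 - d)%N.
  by apply: subset_of_card; rewrite cardsCs setCK card_ord; lia.
have : (k <= weight F m)%N by apply: km; lia.
rewrite /weight big1; first by rewrite leqn0; lia.
move=> i /sF.
by rewrite !inE negbK => /eqP.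
Qed.

(** Dividing a monomial by its radical lowers its least weight by that of the
    radical only: among the sets F it suffices to test those that contain
    the complement of the support. *)
Lemma symbolic_mnm_sub_supp k m : (d <= #|mnm_supp m|)%N ->
  symbolic_mnm d k m ->
  symbolic_mnm d (k - (#|mnm_supp m| - d).+1) (m - sqfree_mnm (mnm_supp m)).
Proof.
move=> dm /symbolic_mnmP km; apply/symbolic_mnmP => F cF.
have [G sG cG] := subset_of_card (leq_card_setI cF dm).
have sGS : G \subset mnm_supp m by apply: subset_trans sG (subsetIr _ _).
have sGF : G \subset F by apply: subset_trans sG (subsetIl _ _).
(* On H the weight of m is its weight on the small part G of F. *)
pose H := ~: mnm_supp m :|: G.
have cH : (#|H| + d = n.+1)%N.
  rewrite cardsU disjoint_setI0; last by rewrite disjoint_sym disjoints_subset setCK.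
  have := cardsC (mnm_supp m); rewrite card_ord cards0 cG; lia.
have wH : weight H m = weight G m.
  rewrite /weight big_mkcond [RHS]big_mkcond; apply: eq_bigr => i _.
  by rewrite !inE negbK; case: (i \in G); rewrite ?orbT // orbF; case: eqP.
have wG : weight G m = (weight G (m - sqfree_mnm (mnm_supp m)) + #|G|)%N.
  by rewrite -[in LHS](submK (m := sqfree_mnm (mnm_supp m)) (m' := m))
       ?sqfree_mnm_le // weightD weight_sqfree (setIidPl sGS).
have wGF : (weight G (m - sqfree_mnm (mnm_supp m)) <=
            weight F (m - sqfree_mnm (mnm_supp m)))%N.
  rewrite /weight big_mkcond [leqRHS]big_mkcond; apply: leq_sum => i _.
  by case: ifP => // /(subsetP sGF) ->.
rewrite leq_subLR; apply: leq_trans (km _ cH) _.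
by rewrite wH wG cG addnC leq_add2l.
Qed.

(** Peeling off radicals: the last factor is cut down so that the least weights
    of the factors add up to k exactly. *)
Lemma symbolic_mnm_factor k m : symbolic_mnm d k m ->
  exists2 s, sqfree_factors k s & (sqfree_prod s <= m)%MM.
Proof.
elim/ltn_ind: k m => -[|k] IHk m km.
  exists [::]; first by rewrite /sqfree_factors big_nil.
  by rewrite /sqfree_prod big_nil; apply/mnm_lepP => i; rewrite mnm0E.
have dm := leq_card_supp (ltn0Sn k) km.
(* If the radical alone has weight at least k, part of it is enough. *)
have [kS|Sk] := leqP k.+1 (#|mnm_supp m| - d).+1.
  have [|A sA cA] := @subset_of_card _ (mnm_supp m) (d + k); first by lia.
  exists [:: A]; last by rewrite /sqfree_prod big_seq1 sqfree_mnm_le.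
  by split; rewrite /= ?big_seq1 cA ?leq_addr // addKn.
have [|s [ds cs] sm] := IHk _ _ _ (symbolic_mnm_sub_supp dm km); first by lia.
exists (mnm_supp m :: s).
  by split; rewrite /= ?dm // big_cons cs subnKC // ltnW.
rewrite /sqfree_prod big_cons -/(sqfree_prod s).
rewrite -{2}(submK (m := sqfree_mnm (mnm_supp m)) (m' := m)).
  by rewrite addmC; apply/mnm_lepP => i; rewrite !mnmDE leq_add2r; apply/mnm_lepP.
by rewrite sqfree_mnm_le.
Qed.

Lemma mdeg_sqfree_prod k s :
  sqfree_factors k s -> mdeg (sqfree_prod s) = (size s * (d - 1) + k)%N.
Proof.
case=> /allP ds <-; rewrite mdeg_weightT weight_sqfree_prod.
elim: s ds => [|A s IHs] ds; first by rewrite !big_nil.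
rewrite !big_cons setTI IHs => [|B sB]; last by rewrite ds ?inE ?sB ?orbT.
have := ds A (mem_head _ _); rewrite /= mulSn.
by move: (size s * _)%N (\sum_(j <- s) _)%N #|A| => u v a; lia.
Qed.

Lemma size_sqfree_factors k s :
  sqfree_factors k s -> (size s <= k <= size s * (n - d + 1))%N.
Proof.
case=> /allP ds <-; elim: s ds => [|A s IHs] ds; first by rewrite big_nil.
have /IHs : forall B, B \in s -> (d <= #|B|)%N.
  by move=> B sB; rewrite ds ?inE ?sB ?orbT.
rewrite big_cons /=; have := max_card A; rewrite card_ord.
have := ds A (mem_head _ _); rewrite mulSn.
by move: (size s * _)%N (\sum_(j <- s) _)%N #|A| => u v a; lia.
Qed.

(** * Minimal exponents of every admissible degree *)

(** The truncated subtraction gives exponent q to the first d indices; from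
    index d - 1 on, the weight k is spread greedily in blocks of at most q. *)
Definition greedy_mnm k q : 'X_{1..n} :=
  [multinom minn q (k - (i - d.-1) * q) | i < n].

(** The n - d + 1 indices of smallest exponent in the greedy vector. *)
Definition tail_set : {set 'I_n} := [set i : 'I_n | (d.-1 <= i)%N].

Lemma tail_set_sum (f : nat -> nat) :
  (\sum_(i in tail_set) f i = \sum_(j < n - d.-1) f (j + d.-1))%N.
Proof.
rewrite (eq_bigl (fun i : 'I_n => true && (d.-1 <= i)%N)) => [|i];
  last by rewrite inE.
by rewrite -(big_geq_mkord d.-1 n xpredT f) -{1}[d.-1]add0n big_addn big_mkord.
Qed.

Lemma card_tail_set : (#|tail_set| + d = n.+1)%N.
Proof.
rewrite -sum1_card (tail_set_sum (fun=> 1%N)) sum1_card card_ord; lia.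
Qed.

Section Greedy.
Variables k q : nat.
Hypotheses (qk : (q <= k)%N) (kq : (k <= q * (n - d + 1))%N).

Lemma greedy_mnm_le i : (greedy_mnm k q i <= q)%N.
Proof. by rewrite mnmE geq_minl. Qed.

Lemma greedy_mnm_head (i : 'I_n) : (i <= d.-1)%N -> greedy_mnm k q i = q.
Proof.
by move=> id; rewrite mnmE (eqP id) mul0n subn0; apply/minn_idPl.
Qed.

Lemma weight_greedy_tail : weight tail_set (greedy_mnm k q) = k.
Proof.
rewrite /weight; under eq_bigr do rewrite mnmE.
rewrite (tail_set_sum (fun i => minn q (k - (i - d.-1) * q))).
under eq_bigr do rewrite addnK.
rewrite sum_minn_blocks; apply/minn_idPr; rewrite mulnC.
by have -> : (n - d.-1 = n - d + 1)%N by lia.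
Qed.

Lemma mdeg_greedy : mdeg (greedy_mnm k q) = (q * (d - 1) + k)%N.
Proof.
rewrite mdeg_weightT /weight (big_setID tail_set) /= setTI.
rewrite -/(weight tail_set _) weight_greedy_tail addnC; congr (_ + _)%N.
rewrite (eq_bigr (fun=> q)) => [|i]; last first.
  by rewrite !inE andbT -ltnNge => /ltnW; apply: greedy_mnm_head.
rewrite sum_nat_const mulnC setTD cardsCs setCK card_ord.
congr (_ * _)%N; have := card_tail_set; move: #|tail_set| => t; lia.
Qed.

(** Outside the tail the exponents take their largest value q, so no other
    index set of that size has smaller weight. *)
Lemma greedy_symbolic : symbolic_mnm d k (greedy_mnm k q).
Proof.
apply/symbolic_mnmP => F cF; rewrite -{1}weight_greedy_tail /weight.
rewrite (big_setID F) [leqRHS](big_setID tail_set) /= setIC leq_add2l.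
apply: (@leq_trans (#|tail_set :\: F| * q)).
  by rewrite -sum_nat_const; apply: leq_sum => i _; apply: greedy_mnm_le.
rewrite [leqRHS](eq_bigr (fun=> q)) => [|i]; last first.
  by rewrite !inE -ltnNge => /andP[/ltnW + _]; apply: greedy_mnm_head.
rewrite sum_nat_const leq_mul2r !cardsD [F :&: _]setIC; apply/orP; right.
by rewrite leq_sub2r // -(leq_add2r d) card_tail_set cF.
Qed.

(** Every index lies in a set F whose inequality is an equality: the tail, or
    the tail with its first index, of exponent q, exchanged for another one of
    exponent q. *)
Lemma greedy_minimal u :
  symbolic_mnm d k u -> (u <= greedy_mnm k q)%MM -> u = greedy_mnm k q.
Proof.
move=> /symbolic_mnmP ku /mnm_lepP ua; apply/mnmP => i.
apply/eqP; rewrite eqn_leq ua /=; apply: contraT; rewrite -ltnNge => lt_i.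
have [F cF [iF wF]] : exists2 F : {set 'I_n}, (#|F| + d = n.+1)%N &
    i \in F /\ weight F (greedy_mnm k q) = k.
  case: (leqP d.-1 i) => id.
    exists tail_set; first exact: card_tail_set.
    by rewrite inE weight_greedy_tail.
  have dn : (d.-1 < n)%N by lia.
  pose j := Ordinal dn; have jT : j \in tail_set by rewrite inE.
  have iT : i \notin tail_set :\ j by rewrite !inE negb_and leqNgt id orbT.
  exists (i |: tail_set :\ j).
    by rewrite cardsU1 iT -card_tail_set (cardsD1 j tail_set) jT.
  split; first by rewrite !inE eqxx.
  rewrite -[RHS]weight_greedy_tail /weight big_setU1 //= [RHS](big_setD1 j) //=.
  by rewrite !greedy_mnm_head // ltnW.
have := ku F cF; rewrite -[X in (X <= _)%N]wF leqNgt => /negP; case.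
rewrite /weight (big_setD1 i) //= [ltnRHS](big_setD1 i) //= -addSn.
by rewrite leq_add // leq_sum.
Qed.

End Greedy.

End Factorization.

(** * Symbolic powers of squarefree Veronese ideals *)

Section SymbolicVeronese.
Variables (K : fieldType) (n d : nat).
Hypothesis hd : (1 <= d <= n)%N.
Implicit Types (F A : {set 'I_n}) (m u v : 'X_{1..n}) (f g : {mpoly K[n]}).
Implicit Types (P L : {mpoly K[n]} -> Prop).

Lemma squarefree_monomialP e f :
  squarefree_monomial e f <->
  exists2 A : {set 'I_n}, #|A| = e & f = 'X_[sqfree_mnm A].
Proof.
split=> [[m [dm m1 ->]]|[A cA ->]]; last first.
  exists (sqfree_mnm A); split=> [|i|//]; first by rewrite mdeg_sqfree.
  by rewrite mnmE leq_b1.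
have Em : m = sqfree_mnm (mnm_supp m).
  apply/mnmP => i; rewrite mnmE inE.
  by have := m1 i; case: (m i) => [|[|]].
by exists (mnm_supp m); rewrite -?Em // -mdeg_sqfree -Em.
Qed.

Lemma veroneseX e A m :
  #|A| = e -> (sqfree_mnm A <= m)%MM -> @veronese K n e 'X_[m].
Proof.
move=> cA Am; apply: ideal_mnm_le Am _; first exact: ideal_gen_is_ideal.
by apply: mem_ideal_gen; apply/squarefree_monomialP; exists A.
Qed.

Lemma veronese_weight F e f : (#|F| + d = n.+1)%N -> (d <= e)%N ->
  veronese e f -> weight_ideal F (e - d).+1 f.
Proof.
move=> cF de; apply: ideal_gen_sub; first exact: weight_ideal_is_ideal.
move=> _ /squarefree_monomialP[A cA ->]; apply/mnm_idealX.
by rewrite weight_sqfree -cA; apply: leq_card_setI; rewrite ?cA.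
Qed.

(** The squarefree Veronese ideal is radical: it is the intersection of the
    primes generated by n - d + 1 variables. *)
Lemma veronese_weightP f : veronese d f <->
  forall F, (#|F| + d = n.+1)%N -> weight_ideal F 1 f.
Proof.
split=> [If F cF|h].
  by have := veronese_weight cF (leqnn d) If; rewrite subnn.
apply: ideal_msupp; first exact: ideal_gen_is_ideal.
move=> m mf; have [|A sA cA] := @subset_of_card _ (mnm_supp m) d.
  apply: (@leq_card_supp _ _ hd 1) => //.
  by apply/symbolic_mnmP => F /h; apply.
by apply: veroneseX cA _; rewrite sqfree_mnm_le.
Qed.

Lemma sqfree_setC_weight F :
  ~ weight_ideal F 1 ('X_[sqfree_mnm (~: F)] : {mpoly K[n]}).
Proof. by move/mnm_idealX; rewrite weight_sqfree setICr cards0. Qed.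

(** The prime of F is the annihilator of the product of the other d - 1
    variables. *)
Lemma weight_ideal_associated F : (#|F| + d = n.+1)%N ->
  associated_prime (@veronese K n d) (weight_ideal F 1).
Proof.
move=> cF; split; first exact: weight_ideal_prime.
exists 'X_[sqfree_mnm (~: F)] => a; split=> [Fa|/veronese_weightP/(_ F cF)].
  apply: ideal_msupp; first exact: ideal_gen_is_ideal.
  move=> _ /msuppM_le/allpairsP[[u v] /= [/Fa Fu + ->]].
  rewrite msuppX inE => /eqP-> {v}.
  have [i iF ui] := weight_gt0 Fu.
  apply: (@veroneseX _ (i |: ~: F)).
    rewrite cardsU1 inE negbK iF cardsCs setCK card_ord; lia.
  apply/mnm_lepP => j; rewrite mnmDE !mnmE !inE.
  by have [->|_] := eqVneq j i; [rewrite iF addn0 lt0n | rewrite leq_addl].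
by rewrite mulrC; apply: weight_ideal_primary; apply: sqfree_setC_weight.
Qed.

(** An associated prime is (I : g) with g outside I, hence outside one of the
    primes whose intersection is I, and it is contained in that prime. *)
Lemma associated_prime_sub P : associated_prime (@veronese K n d) P ->
  exists2 F : {set 'I_n}, (#|F| + d = n.+1)%N & forall a, P a -> weight_ideal F 1 a.
Proof.
move=> [[_ P1 _] [g Pg]].
have ng :
    ~ (forall F : {set 'I_n}, (#|F| + d = n.+1)%N -> weight_ideal F 1 g).
  by move/veronese_weightP; rewrite -[g]mul1r => /Pg.
have [F FP] := not_all_ex_not _ _ ng; have [cF Fg] := imply_to_and _ _ FP.
exists F => // a /Pg /veronese_weightP/(_ F cF); rewrite mulrC.
exact: weight_ideal_primary.
Qed.

Lemma veronese_exp_weight F k f : (#|F| + d = n.+1)%N ->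
  ideal_exp (@veronese K n d) k f -> weight_ideal F k f.
Proof.
move=> cF; elim: k f => [|k IHk] f; first by move=> _ m.
apply: ideal_gen_sub => [|_ [g [h [/veronese_weightP/(_ F cF) Fg /IHk Fh ->]]]].
  exact: weight_ideal_is_ideal.
by rewrite -add1n; apply: weight_idealM.
Qed.

(** Each variable of F times the product of the variables outside F is a
    generator of the Veronese ideal, so the k-th power of that product clears
    the denominators. *)
Lemma weight_veronese_exp F k f : (#|F| + d = n.+1)%N -> weight_ideal F k f ->
  ideal_exp (@veronese K n d) k ('X_[sqfree_mnm (~: F)] ^+ k * f).
Proof.
move=> cF kf; apply: ideal_msupp; first exact: ideal_exp_is_ideal.
move=> _ /msuppM_le/allpairsP[[v u] /= [+ /kf ku ->]].
rewrite mpolyXn msuppX inE => /eqP-> {v f kf}.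
elim: k u ku => [//|k IHk] u ku.
have [i iF ui] := weight_gt0 (leq_trans (ltn0Sn k) ku).
have Ui : (U_(i) <= u)%MM by rewrite lep1mP.
have -> : (sqfree_mnm (~: F) *+ k.+1 + u =
    (sqfree_mnm (~: F) + U_(i)) + (sqfree_mnm (~: F) *+ k + (u - U_(i))))%MM.
  by rewrite mulmS -{1}(submK Ui) -!addmA; congr (_ + _)%MM; rewrite addmA addmC.
rewrite mpolyXD; apply: (@mem_ideal_mul _ _ (ideal_exp (@veronese K n d) k)).
  apply: (@veroneseX _ (i |: ~: F)).
    rewrite cardsU1 inE negbK iF cardsCs setCK card_ord; lia.
  apply/mnm_lepP => j; rewrite mnmDE !mnmE !inE eq_sym.
  by case: (i == j); rewrite ?leq_addl ?leq_addr.
apply: IHk; move: ku; rewrite -{1}(submK Ui) weightD.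
by rewrite {2}/weight (big_setD1 i) //= mnm1E eqxx big1 ?addn1 // => j;
  rewrite !inE mnm1E eq_sym => /andP[/negPf->].
Qed.

(** The associated primes that matter are those generated by n - d + 1 variables,
    and their powers are primary, so localizing at them loses nothing. *)
Lemma symbolic_veroneseP k f :
  symbolic_power (@veronese K n d) k f <-> mnm_ideal (symbolic_mnm d k) f.
Proof.
split=> [Ikf m mf|Uf P assP].
  apply/symbolic_mnmP => F cF.
  have := Ikf _ (weight_ideal_associated cF).
  move/ideal_extensionP => /(_ (weight_ideal_prime _ _) (ideal_exp_is_ideal _ _)).
  move=> [s Fs /(veronese_exp_weight cF)] Fsf.
  exact: (weight_ideal_primary Fs Fsf).
have [F cF PF] := associated_prime_sub assP; have [Pprime _] := assP.
apply/ideal_extensionP; [by [] | exact: ideal_exp_is_ideal |].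
exists ('X_[sqfree_mnm (~: F)] ^+ k).
  move/PF; elim: k {Uf} => [|k IHk]; first by case: (weight_ideal_prime K F).
  rewrite exprS => /(weight_ideal_primary (@sqfree_setC_weight F)).
  exact: IHk.
apply: weight_veronese_exp => // m /Uf /symbolic_mnmP; exact.
Qed.

Lemma symbolic_ideal_is_ideal k :
  is_ideal (mnm_ideal (K := K) (symbolic_mnm (n := n) d k)).
Proof.
by apply: mnm_ideal_is_ideal => u v; apply: symbolic_mnm_le; apply: lem_addr.
Qed.

(** * The decomposition into products of Veronese ideals *)

Definition veronese_product (m : nat) (s : {ffun 'I_m -> 'I_(n - d).+1}) :=
  \big[@ideal_mul {mpoly K[n]} / @ideal1 {mpoly K[n]}]_(i < m)
     @veronese K n (d + s i).

Definition veronese_product_sum (k m : nat) :=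
  \big[@ideal_add {mpoly K[n]} / @ideal0 {mpoly K[n]}]_(
      s : {ffun 'I_m -> 'I_(n - d).+1} | (\sum_(i < m) s i == k - m)%N)
    veronese_product s.

Lemma veronese_product_weight F (m : nat) (s : {ffun 'I_m -> 'I_(n - d).+1}) f :
  (#|F| + d = n.+1)%N -> veronese_product s f ->
  weight_ideal F (\sum_(i < m) (s i).+1) f.
Proof.
move=> cF; rewrite /veronese_product; move: f.
elim/big_ind2: _ => [f _ u //|I a J b Ia Jb|i _ f /(veronese_weight cF)].
  apply: ideal_gen_sub => [|_ [g [h [/Ia Fg /Jb Fh ->]]]].
    exact: weight_ideal_is_ideal.
  exact: weight_idealM.
by rewrite addKn; apply; apply: leq_addr.
Qed.

Lemma veronese_productX (m : nat) (s : {ffun 'I_m -> 'I_(n - d).+1})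
    (A : 'I_m -> {set 'I_n}) :
  (forall i, #|A i| = d + s i)%N ->
  veronese_product s 'X_[\sum_(i < m) sqfree_mnm (A i)].
Proof.
move=> cA; rewrite -mprodXE /veronese_product.
elim/big_ind2: _ => [//|I a J b|i _]; first exact: mem_ideal_mul.
exact: veroneseX (cA i) (lepm_refl _).
Qed.

Lemma veronese_product_is_ideal (m : nat) (s : {ffun 'I_m -> 'I_(n - d).+1}) :
  is_ideal (veronese_product s).
Proof. by apply: ideal_big_mul_is_ideal => i _; apply: ideal_gen_is_ideal. Qed.

Lemma veronese_product_sum_is_ideal (k m : nat) :
  is_ideal (veronese_product_sum k m).
Proof.
by apply: ideal_big_add_is_ideal => s _; apply: veronese_product_is_ideal.
Qed.

Lemma symbolic_veronese_sum k : (1 <= k)%N ->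
  ideal_eq (symbolic_power (@veronese K n d) k)
    (\big[@ideal_add {mpoly K[n]} / @ideal0 {mpoly K[n]}]_(1 <= m < k.+1)
       veronese_product_sum k m).
Proof.
move=> k0 f; split=> [/symbolic_veroneseP Uf|Sf]; last first.
  apply/symbolic_veroneseP; move: f Sf.
  apply: ideal_big_add_sub => [|m]; first exact: symbolic_ideal_is_ideal.
  rewrite mem_index_iota => /andP[m0 mk] _.
  apply: ideal_big_add_sub => [|s _ /eqP Es f sf u uf].
    exact: symbolic_ideal_is_ideal.
  apply/symbolic_mnmP => F cF.
  have := veronese_product_weight cF sf uf.
  under eq_bigr do rewrite -addn1.
  by rewrite big_split /= Es sum1_card card_ord subnK.
apply: ideal_msupp => [|u /Uf /(symbolic_mnm_factor hd) [s fs su]].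
  by apply: ideal_big_add_is_ideal => m _; apply: veronese_product_sum_is_ideal.
have [ds cs] := fs; have /andP[sk ks] := size_sqfree_factors hd fs.
apply: (@mem_ideal_big_add _ _ _ _ _ (size s)) => //.
- by move=> m _; apply: veronese_product_sum_is_ideal.
- by rewrite mem_index_iota ltnS sk andbT lt0n; apply: contraTneq ks => ->; lia.
pose A (i : 'I_(size s)) := nth set0 s i.
have dA i : (d <= #|A i|)%N by apply: (allP ds); apply: mem_nth.
have lt_nd i : (#|A i| - d < (n - d).+1)%N.
  by rewrite ltnS leq_sub2r // -[leqRHS]card_ord max_card.
(* The factor of degree d + j is a generator of the Veronese ideal of that
   degree. *)
pose t := [ffun i : 'I_(size s) => Ordinal (lt_nd i)].
apply: (@mem_ideal_big_add _ _ _ _ _ t).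
- by move=> r _; apply: veronese_product_is_ideal.
- by rewrite mem_index_enum.
- rewrite (eq_bigr (fun i => #|A i| - d)%N) => [|i _]; last by rewrite ffunE.
  rewrite -(eqn_add2r (size s)) subnK // -[in X in (_ == X)%N]cs.
  rewrite (big_nth set0) big_mkord -[X in (_ + X)%N]card_ord -sum1_card.
  rewrite -big_split /=.
  by apply/eqP; apply: eq_bigr => i _; rewrite addn1.
apply: ideal_mnm_le su _; first exact: veronese_product_is_ideal.
rewrite /sqfree_prod (big_nth set0) big_mkord; apply: veronese_productX => i.
by rewrite ffunE /= subnKC.
Qed.

End SymbolicVeronese.

(** * Minimal generators of monomial ideals *)

Section MinimalGenerators.
Variables (K : fieldType) (n : nat).
Implicit Types (m u v : 'X_{1..n}) (f g : {mpoly K[n]}).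
Implicit Types (L : {mpoly K[n]} -> Prop) (G H : seq {mpoly K[n]}).

Definition homogeneous_seq G : Prop :=
  forall g, g \in G -> exists e : nat, g \is e.-homog.

(** Among the finite homogeneous systems of generators one of least size is
    irredundant, so the choice operator does select a minimal system. *)
Lemma mingens_spec L G :
  homogeneous_seq G -> generates G L -> is_mingens L (mingens L).
Proof.
move=> homG genG; apply: epsilon_spec.
have [N] := ubnP (size G); elim: N G homG genG => // N IHN G homG genG szG.
case: (classic (exists H,
    [/\ homogeneous_seq H, generates H L & (size H < size G)%N])).
  by case=> H [homH genH szH]; apply: (IHN H) => //; apply: leq_trans szH _.
move=> noH; exists G; split=> // [|H HG genH].
  rewrite -[uniq G]negbK -ltn_size_undup; apply/negP => szU; apply: noH.
  exists (undup G); split=> // [g|f]; first by rewrite mem_undup => /homG.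
  apply: iff_trans (genG f); split; apply: ideal_gen_mono => g;
    by rewrite mem_undup.
have [ltH|szH] := boolP (size (undup H) < size G)%N.
  case: noH; exists (undup H); split=> // [g|f].
    by rewrite mem_undup => /HG/homG.
  apply: iff_trans (genH f); split; apply: ideal_gen_mono => g;
    by rewrite mem_undup.
have HG' : {subset undup H <= G} by move=> g; rewrite mem_undup => /HG.
rewrite -leqNgt in szH.
have [_ EH] := uniq_min_size (undup_uniq H) HG' szH.
by move=> g; rewrite -EH mem_undup.
Qed.

Lemma dhomog_tdeg g e : g \is e.-homog -> g \is (tdeg g).-homog.
Proof. exact: dhomog_msize. Qed.

Lemma pihomog_mulr e a g : g \is (tdeg g).-homog ->
  exists2 b, pihomog mdeg e (a * g) = b * g & (e < tdeg g)%N -> b = 0.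
Proof.
move=> homg; pose N := msize a.
exists (\sum_(i < N) if (i + tdeg g == e)%N then pihomog mdeg i a else 0).
  rewrite {1}(pihomog_partitionE (mf := mdeg) (leqnn (msize a))) mulr_suml.
  rewrite raddf_sum mulr_suml; apply: eq_bigr => i _ /=.
  have homi : pihomog mdeg i a * g \is (i + tdeg g).-homog.
    by apply: dhomogM => //; apply: pihomogP.
  have [<-|ne] := eqVneq; first by rewrite pihomog_dE.
  by rewrite mul0r (pihomog_ne0 ne homi).
move=> lt_e; apply: big1 => i _; case: eqP => // Ee.
by move: lt_e; rewrite -Ee ltnNge leq_addl.
Qed.

(** Only generators of degree at most e contribute to the component of
    degree e. *)
Lemma ideal_gen_homog G f e : homogeneous_seq G -> f \is e.-homog ->
  ideal_gen (fun g => g \in G) f ->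
  ideal_gen (fun g => g \in G /\ (tdeg g <= e)%N) f.
Proof.
move=> homG homf [c cG Ef]; rewrite -(pihomog_dE homf) Ef raddf_sum.
apply: ideal_sum => [|t tc]; first exact: ideal_gen_is_ideal.
have [e' /dhomog_tdeg homt] := homG _ (cG t tc).
have [b /= -> b0] := pihomog_mulr e t.1 homt.
have [id0 _ idM] := ideal_gen_is_ideal (fun g => g \in G /\ (tdeg g <= e)%N).
have [te|/b0->] := leqP (tdeg t.2) e; last first.
  by rewrite mul0r.
by apply: idM; apply: mem_ideal_gen; split=> //; apply: cG.
Qed.

Section MonomialIdeal.
Variables (U : pred 'X_{1..n}) (L : {mpoly K[n]} -> Prop).
Hypothesis Uup : forall u v, U u -> U (u + v)%MM.
Hypothesis LU : ideal_eq L (mnm_ideal U).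

Definition minimal_mnm m : Prop :=
  U m /\ forall u, U u -> (u <= m)%MM -> u = m.

(** A minimal monomial appears in some multiple of a generator g, hence it
    is a multiple of a monomial of g, which lies in the ideal and so equals it. *)
Lemma mingens_of_minimal G m : is_mingens L G -> minimal_mnm m ->
  exists2 g, g \in G & tdeg g = mdeg m.
Proof.
move=> [_ homG genG _] [Um minm].
have : L 'X_[m] by apply/LU/mnm_idealX.
case/genG => c cG Em; have : 'X_[m]@_m != 0 :> K by rewrite mcoeffX eqxx oner_eq0.
rewrite Em -mcoeff_msupp => /msupp_sum_le /flattenP[_ /mapP[t tc ->]].
rewrite mem_filter /= in tc.
move=> /msuppM_le/allpairsP[[v u] /= [_ ut Evu]]; have Gt := cG t tc.
have Uu : U u by apply: (iffLR (LU t.2)) ut; apply/genG; apply: mem_ideal_gen.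
have Eu : u = m by apply: minm => //; rewrite Evu lem_addl.
exists t.2 => //; have [e /dhomog_tdeg /dhomogP homt] := homG _ Gt.
by rewrite -(homt _ ut) Eu.
Qed.

(** If no monomial of g is minimal, then all of them are multiples of members of
    L of smaller degree, which the other generators already generate. *)
Lemma minimal_of_mingens G g : is_mingens L G -> g \in G ->
  exists2 m, minimal_mnm m & mdeg m = tdeg g.
Proof.
move=> [uG homG genG minG] Gg; apply: NNPP => nomin.
have [e /dhomog_tdeg /dhomogP homg] := homG _ Gg.
have Lid : is_ideal L.
  have [J0 JD JM] := mnm_ideal_is_ideal K Uup.
  by split=> [|f h /LU Lf /LU Lh|a f /LU Lf]; apply/LU; auto.
pose J := ideal_gen (fun h => h \in rem g G).
have Jid : is_ideal J by apply: ideal_gen_is_ideal.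
have Jg : J g.
  apply: ideal_msupp => // m mg.
  have [u [Uu um nem]] : exists u, [/\ U u, (u <= m)%MM & u <> m].
    apply: NNPP => nou; apply: nomin; exists m; last exact: homg.
    split=> [|u Uu um]; first by apply: (iffLR (LU g)) mg; apply/genG/mem_ideal_gen.
    by apply: NNPP => nem; apply: nou; exists u.
  have lt_deg : (mdeg u < tdeg g)%N.
    have <- : mdeg m = tdeg g := homg _ mg.
    rewrite -{1}(submK um) mdegD -[ltnLHS]add0n ltn_add2r lt0n mdeg_eq0.
    by apply: contra_notN nem => /eqP E; rewrite -{1}(submK um) E add0m.
  apply: ideal_mnm_le um _ => //.
  have Gu : ideal_gen (fun h => h \in G) 'X_[u].
    by apply/genG/LU/mnm_idealX.
  have homu : ('X_[u] : {mpoly K[n]}) \is (mdeg u).-homog by rewrite dhomogX.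
  apply: ideal_gen_mono (ideal_gen_homog homG homu Gu) => h [Gh hu].
  rewrite mem_rem_uniq // inE Gh andbT.
  by apply: contraTneq hu => ->; rewrite -ltnNge.
have /(_ g Gg) : {subset G <= rem g G}.
  apply: minG => [h|f]; first exact: mem_rem.
  apply: iff_trans (genG f); split; first by apply: ideal_gen_mono => h /mem_rem.
  apply: ideal_gen_sub => // h Gh; have [->//|neh] := eqVneq h g.
  by apply: mem_ideal_gen; rewrite mem_rem_uniq // inE neh.
by rewrite mem_rem_uniq // inE eqxx.
Qed.

(** Generation by finitely many monomials. *)
Hypothesis Ubounded : exists N, forall m, U m ->
  exists u, [/\ U u, (u <= m)%MM & (mdeg u <= N)%N].

Lemma monomial_mingens : is_mingens L (mingens L).
Proof.
have [N bU] := Ubounded.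
pose G := [seq ('X_[val m] : {mpoly K[n]}) |
  m : 'X_{1..n < N.+1} <- enum {: 'X_{1..n < N.+1}} & U (val m)].
have GU h : h \in G -> exists2 m, U m & h = 'X_[m].
  case/mapP => m; rewrite mem_filter => /andP[Um _] ->.
  by exists (val m).
apply: (@mingens_spec L G) => [_ /GU[m _ ->]|f].
  by exists (mdeg m); rewrite dhomogX.
have Uid := mnm_ideal_is_ideal K Uup.
apply: iff_trans (iff_sym (LU f)); split.
  by apply: ideal_gen_sub => // _ /GU[m Um ->]; apply/mnm_idealX.
have Gid := ideal_gen_is_ideal (fun h => h \in G).
move=> Uf; apply: ideal_msupp => // m /Uf/bU[u [Uu um uN]].
apply: ideal_mnm_le um _ => //; apply: mem_ideal_gen.
apply/mapP; have uN' : (mdeg u < N.+1)%N by [].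
by exists (BMultinom uN'); rewrite // mem_filter mem_enum Uu.
Qed.

Lemma beta0_minimal l :
  beta0 L l <> 0%N <-> exists2 m, minimal_mnm m & mdeg m = l.
Proof.
rewrite /beta0; split=> [/eqP|[m minm <-]].
  rewrite -lt0n -has_count => /hasP[g Gg /eqP<-].
  exact: minimal_of_mingens monomial_mingens Gg.
apply/eqP; rewrite -lt0n -has_count; apply/hasP.
by have [g Gg dg] := mingens_of_minimal monomial_mingens minm; exists g; rewrite ?dg.
Qed.

Lemma omega_minimal N :
  (exists2 m, minimal_mnm m & mdeg m = N) ->
  (forall m, minimal_mnm m -> (mdeg m <= N)%N) -> omega L = N.
Proof.
move=> [m minm dm] leN; apply/eqP; rewrite eqn_leq; apply/andP; split.
  apply/bigmax_leqP_seq => g Gg _.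
  by have [u /leN uN <-] := minimal_of_mingens monomial_mingens Gg.
have [g Gg Eg] := mingens_of_minimal monomial_mingens minm.
by rewrite -dm -Eg; apply: (@leq_bigmax_seq _ _ _ (@tdeg K n)).
Qed.

End MonomialIdeal.
End MinimalGenerators.

(** * Degrees of the generators of the symbolic powers *)

Section SymbolicGenerators.
Variables (n d : nat).
Hypothesis hd : (1 <= d <= n)%N.

(** A minimal monomial equals the product of squarefree factors dividing it, whose
    degree depends on the number of factors only; the greedy vectors realize
    every admissible number. *)
Lemma minimal_symbolic_degree k l :
  (exists2 m : 'X_{1..n}, minimal_mnm (symbolic_mnm d k) m & mdeg m = l) <->
  exists q, [/\ (k <= q * (n - d + 1))%N, (q <= k)%N & l = (q * (d - 1) + k)%N].
Proof.
split=> [[m [Um minm] <-]|[q [kq qk ->]]].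
  have [s fs sm] := symbolic_mnm_factor hd Um.
  have <- : sqfree_prod s = m by apply: minm => //; apply: symbolic_sqfree_prod.
  have /andP[sk ks] := size_sqfree_factors hd fs.
  by exists (size s); rewrite (mdeg_sqfree_prod hd fs).
exists (greedy_mnm n d k q); last exact: mdeg_greedy.
split=> [|u]; [exact: greedy_symbolic | exact: greedy_minimal].
Qed.

Lemma symbolic_mnm_bounded k : exists N, forall m : 'X_{1..n},
  symbolic_mnm d k m ->
  exists u, [/\ symbolic_mnm d k u, (u <= m)%MM & (mdeg u <= N)%N].
Proof.
exists (k * d)%N => m /(symbolic_mnm_factor hd)[s fs sm].
exists (sqfree_prod s); split=> //; first exact: symbolic_sqfree_prod.
have /andP[sk _] := size_sqfree_factors hd fs.
have : (size s * (d - 1) <= k * (d - 1))%N by rewrite leq_mul2r sk orbT.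
rewrite (mdeg_sqfree_prod hd fs).
by case: d hd => // d' _; rewrite subn1 /= mulnS; lia.
Qed.

End SymbolicGenerators.

Lemma ceil_div_le (k N m : nat) : (0 < N)%N ->
  (Num.ceil (k%:R / N%:R : rat) <= m%:Z) = (k <= m * N)%N.
Proof.
move=> N0; rewrite ceil_le_int ler_pdivrMr ?ltr0n //.
by rewrite -[m%:~R]/(m%:R) -natrM ler_nat.
Qed.

Theorem theorem3p4 (K : fieldType) (n d : nat) (hd : (1 <= d <= n)%N)
    (k : nat) (hk : (1 <= k)%N) :
  [/\ ideal_eq (symbolic_power (@veronese K n d) k)
        (\big[@ideal_add {mpoly K[n]} / @ideal0 {mpoly K[n]}]_(1 <= m < k.+1)
          \big[@ideal_add {mpoly K[n]} / @ideal0 {mpoly K[n]}]_(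
              s : {ffun 'I_m -> 'I_(n - d).+1} | (\sum_(i < m) s i == k - m)%N)
            \big[@ideal_mul {mpoly K[n]} / @ideal1 {mpoly K[n]}]_(i < m)
              @veronese K n (d + s i)),
      forall l : nat,
        beta0 (symbolic_power (@veronese K n d) k) l <> 0%N <->
        exists m : nat,
          [/\ Num.ceil (k%:R / (n - d + 1)%:R : rat) <= m%:Z, (m <= k)%N
            & l = (m * (d - 1) + k)%N]
    & omega (symbolic_power (@veronese K n d) k) = (d * k)%N].
Proof.
have LU : ideal_eq (symbolic_power (@veronese K n d) k)
    (mnm_ideal (symbolic_mnm d k)) by move=> f; apply: symbolic_veroneseP.
have Uup (u v : 'X_{1..n}) : symbolic_mnm d k u -> symbolic_mnm d k (u + v)%MM.
  by apply: symbolic_mnm_le; apply: lem_addr.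
have bU := symbolic_mnm_bounded hd k.
have Edk : (d * k = k * (d - 1) + k)%N.
  by have /andP[d0 _] := hd; rewrite addnC -mulnS subn1 prednK // mulnC.
split; first exact: symbolic_veronese_sum.
  move=> l; apply: iff_trans (beta0_minimal Uup LU bU l) _.
  apply: iff_trans (minimal_symbolic_degree hd k l) _.
  by split=> -[q [kq qk El]]; exists q; move: kq; rewrite ceil_div_le ?addn1.
apply: (omega_minimal Uup LU bU) => [|m minm].
  apply/(minimal_symbolic_degree hd); exists k; split=> //.
  by rewrite leq_pmulr // addn1.
have [q [_ qk ->]] : exists q, [/\ (k <= q * (n - d + 1))%N, (q <= k)%N
    & mdeg m = (q * (d - 1) + k)%N].
  by apply/(minimal_symbolic_degree hd); exists m.
by rewrite Edk leq_add2r leq_mul2r qk orbT.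
Qed.
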